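(* Let $V$ be a vector space over a field $\mathbb{F}$, let $D_1:V^n\to\mathbb{F}$ be an $n$-determinant on $V$, and let $D_2:V^n\to\mathbb{F}$ be a multilinear and antisymmetric function. Then there is $c\in\mathbb{F}$ such that $$D_2(T)=c\cdot D_1(T)$$ for any $n$-tuple $T$ of vectors in $V$. In particular, if $D_2$ is an $n$-determinant on $V$, then $c\ne 0$.
   Context: Here $n\ge 1$ is an integer and $\mathbb{F}$ is an arbitrary field. Given a vector space $V$ over $\mathbb{F}$, an $n$-determinant on $V$ is a non-zero function $D:V^n\to\mathbb{F}$ (that is, not identically zero) such that for any vectors $v_1,\ldots,v_n,b$ in $V$ one has $$D(v_1,\ldots,v_n)\cdot b=\sum_{k=1}^n D(v_1,\ldots,v_{k-1},b,v_{k+1},\ldots,v_n)\cdot v_k,$$ and such that $V$ is not spanned by any set of $n-1$ vectors in $V$ (in other words, the dimension of $V$ over $\mathbb{F}$ is $n$). A function $f:V^n\to\mathbb{F}$ is multilinear if it is additive and homogeneous of degree $1$ in each variable independently. A function $f:V^n\to\mathbb{F}$ is antisymmetric (also called alternating) if its value changes sign whenever any pair of its arguments is interchanged: for all $1\le i<j\le n$, $$f(u_1,\ldots,u_j,\ldots,u_i,\ldots,u_n)=-f(u_1,\ldots,u_i,\ldots,u_j,\ldots,u_n).$$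
   Formalization: In characteristic 2, D_2 is additionally assumed to vanish whenever two of its arguments coincide; with antisymmetry only as sign change the claim fails there, e.g. D_2(x,y)=x_1y_1 on F_2^2. *)

(* Defs.v *)
From mathcomp Require Import all_boot all_order all_algebra all_fingroup.

Set Implicit Arguments.
Unset Strict Implicit.
Unset Printing Implicit Defensive.

Import GRing.Theory.
Local Open Scope ring_scope.

(* [V ^ n] is the type [{ffun 'I_n -> V}] of n-tuples of vectors.             *)

Definition replace (V : Type) (n : nat) (v : V ^ n) (k : 'I_n) (b : V) : V ^ n :=
  [ffun j => if j == k then b else v j].

Definition swap (V : Type) (n : nat) (u : V ^ n) (i j : 'I_n) : V ^ n :=
  [ffun k => u (tperm i j k)].

(* Families rather than sets: repetitions are allowed, so that the absence of *)
(* a spanning m-family means that the dimension exceeds m even when V has     *)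
(* fewer than m elements.                                                     *)
Definition spans (F : fieldType) (V : lmodType F) (m : nat) (w : V ^ m) : Prop :=
  forall v : V, exists a : F ^ m, v = \sum_(i < m) a i *: w i.

Definition is_ndeterminant (F : fieldType) (V : lmodType F) (n : nat)
    (D : V ^ n -> F) : Prop :=
  [/\ exists v : V ^ n, D v != 0,
      forall (v : V ^ n) (b : V),
        D v *: b = \sum_(k < n) D (replace v k b) *: v k
    & forall w : V ^ n.-1, ~ spans w].

Definition multilinear (F : fieldType) (V : lmodType F) (n : nat)
    (f : V ^ n -> F) : Prop :=
  (forall (i : 'I_n) (u : V ^ n) (x y : V),
     f (replace u i (x + y)) = f (replace u i x) + f (replace u i y)) /\
  (forall (i : 'I_n) (u : V ^ n) (a : F) (x : V),
     f (replace u i (a *: x)) = a * f (replace u i x)).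

Definition antisymmetric_map (F : fieldType) (V : lmodType F) (n : nat)
    (f : V ^ n -> F) : Prop :=
  forall (u : V ^ n) (i j : 'I_n), (i < j)%N -> f (swap u i j) = - f u.

(* This follows from antisymmetric_map when 2 is nonzero in F. In             *)
(* characteristic 2 it does not: (x, y) |-> x_1 * y_1 on F^2 is bilinear and  *)
(* changes sign (trivially) under the swap, yet it is not a multiple of the   *)
(* determinant.                                                               *)
Definition vanishes_on_repeats (F : fieldType) (V : lmodType F) (n : nat)
    (f : V ^ n -> F) : Prop :=
  forall (u : V ^ n) (i j : 'I_n), (i < j)%N -> u i = u j -> f u = 0.

(* Main.v *)
Require Import Defs.
From mathcomp Require Import all_boot all_order all_algebra all_fingroup.

Set Implicit Arguments.
Unset Strict Implicit.
Unset Printing Implicit Defensive.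

Import GRing.Theory.
Local Open Scope ring_scope.

(* If D1 v <> 0, the defining identity makes v a spanning family of minimal   *)
(* size, hence a basis, and D1 (replace v k b) / D1 v is the k-th coordinate  *)
(* of b. So D1 is itself multilinear and vanishes on tuples with a repeated   *)
(* entry. Fixing v with D1 v <> 0, the form D1 v * D2 - D2 v * D1 is          *)
(* multilinear and alternating and vanishes on the basis v, so it is zero.    *)

(** The defining identity of [D1] is Cramer's rule: wherever [D1] is nonzero its argument is a
    basis, by [ndeterminant_spans] and [ndeterminant_free]. Comparing coordinates in such bases
    gives [ndeterminant_linear] and [ndeterminant_vanishes_on_repeats]. Multilinear alternating
    forms are determined by their value on one basis ([alternating_eq0]), so [D1] and [D2] are
    proportional. *)

Lemma replace_replace (V : Type) n (u : V ^ n) (i : 'I_n) (x y : V) :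
  replace (replace u i x) i y = replace u i y.
Proof. by apply/ffunP => k; rewrite !ffunE; case: eqP. Qed.

Lemma replace_id (V : Type) n (u : V ^ n) (i : 'I_n) : replace u i (u i) = u.
Proof. by apply/ffunP => k; rewrite ffunE; case: eqP => [->|]. Qed.

Lemma replaceC (V : Type) n (u : V ^ n) (i j : 'I_n) (x y : V) :
  i != j -> replace (replace u i x) j y = replace (replace u j y) i x.
Proof.
move=> neq_ij; apply/ffunP => k; rewrite !ffunE.
by case: (eqVneq k j) => [->|//]; rewrite eq_sym (negbTE neq_ij).
Qed.

Lemma swap_replace (V : Type) n (u : V ^ n) (i j : 'I_n) :
  i != j -> swap u i j = replace (replace u i (u j)) j (u i).
Proof.
move=> neq_ij; apply/ffunP => k; rewrite !ffunE.
case: tpermP => [->|->|/eqP/negbTE-> /eqP/negbTE-> //]; rewrite eqxx //.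
by rewrite (negbTE neq_ij).
Qed.

Section Determinant.

Variables (F : fieldType) (V : lmodType F) (n : nat).
Implicit Types (u v w : V ^ n) (D f : V ^ n -> F).

(** A relation with [a k] nonzero eliminates [v k], leaving a spanning family of [n.-1] vectors. *)
Lemma minimal_spans_free v (a : 'I_n -> F) :
    spans v -> (forall w : V ^ n.-1, ~ spans w) ->
  \sum_(k < n) a k *: v k = 0 -> forall k, a k = 0.
Proof.
move=> span_v no_span sum0 k; apply/eqP/negPn/negP => ak_neq0.
apply: (no_span [ffun i => v (lift k i)]) => b.
have [c ->] := span_v b.
(* The multiple of the relation subtracted from [c] is the one that makes [d k] zero. *)
pose d i := c i - c k / a k * a i.
exists [ffun i => d (lift k i)].
have -> : \sum_(i < n) c i *: v i = \sum_(i < n) d i *: v i.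
  under [RHS]eq_bigr => i _ do rewrite scalerBl -scalerA.
  by rewrite sumrB -scaler_sumr sum0 scaler0 subr0.
rewrite (bigD1_ord k) //= /d divfK // subrr scale0r add0r.
by apply: eq_bigr => i _; rewrite !ffunE.
Qed.

Lemma ndeterminant_spans D v : is_ndeterminant D -> D v != 0 -> spans v.
Proof.
move=> [_ idD _] Dv_neq0 b; exists [ffun k => (D v)^-1 * D (replace v k b)].
under eq_bigr => k _ do rewrite ffunE -scalerA.
by rewrite -scaler_sumr -idD scalerA mulVf // scale1r.
Qed.

Lemma ndeterminant_free D v (a : 'I_n -> F) :
    is_ndeterminant D -> D v != 0 ->
  \sum_(k < n) a k *: v k = 0 -> forall k, a k = 0.
Proof.
move=> detD Dv_neq0; apply: minimal_spans_free.
  exact: ndeterminant_spans detD Dv_neq0.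
by case: detD.
Qed.

Lemma ndeterminant_vanishes_on_repeats D :
  is_ndeterminant D -> vanishes_on_repeats D.
Proof.
move=> detD u i j lt_ij eq_u; apply/eqP/negPn/negP => Du_neq0.
have neq_ij : i != j by rewrite neq_ltn lt_ij.
(* A repeated entry is the linear relation [u i - u j = 0]. *)
pose a (k : 'I_n) : F := (k == i)%:R - (k == j)%:R.
suff /(ndeterminant_free detD Du_neq0)/(_ i)/eqP : \sum_(k < n) a k *: u k = 0.
  by rewrite /a eqxx (negbTE neq_ij) subr0 oner_eq0.
under eq_bigr => k _ do rewrite scalerBl !scaler_nat !mulrb.
by rewrite sumrB -!big_mkcond !big_pred1_eq eq_u subrr.
Qed.

Lemma ndeterminant_linear D u (i : 'I_n) (a : F) (x y : V) :
    is_ndeterminant D ->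
  D (replace u i (a *: x + y)) = a * D (replace u i x) + D (replace u i y).
Proof.
move=> detD.
(* If one of the three tuples in the claim has nonzero [D], it is a basis [w] differing from [u] at
   most in slot [i]. Expanding [a *: x + y], [x] and [y] in [w] and comparing coordinates at [i]
   gives linearity. If all three values vanish, the claim is trivial. *)
have lin z : D (replace u i z) != 0 ->
    D (replace u i (a *: x + y)) = a * D (replace u i x) + D (replace u i y).
  set w := replace u i z => Dw_neq0.
  pose e k := D (replace w k (a *: x + y))
              - (a * D (replace w k x) + D (replace w k y)).
  have : \sum_(k < n) e k *: w k = 0.
    under eq_bigr => k _ do rewrite scalerBl scalerDl -scalerA.
    have [_ idD _] := detD.
    rewrite sumrB big_split -scaler_sumr /= -!idD scalerDr !scalerA.
    by rewrite (mulrC a) subrr.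
  move=> /(ndeterminant_free detD Dw_neq0)/(_ i)/eqP.
  by rewrite /e !replace_replace subr_eq0 => /eqP.
have [Dx0|] := eqVneq (D (replace u i x)) 0; last exact: lin.
have [Dy0|] := eqVneq (D (replace u i y)) 0; last exact: lin.
have [Ds0|] := eqVneq (D (replace u i (a *: x + y))) 0; last exact: lin.
by rewrite Dx0 Dy0 Ds0 mulr0 addr0.
Qed.

Lemma ndeterminant_multilinear D : is_ndeterminant D -> multilinear D.
Proof.
move=> detD.
have addD i u x y :
    D (replace u i (x + y)) = D (replace u i x) + D (replace u i y).
  by rewrite -[x in LHS]scale1r ndeterminant_linear // mul1r.
split=> // i u a x; rewrite -[a *: x]addr0 ndeterminant_linear //.
suff -> : D (replace u i 0) = 0 by rewrite addr0.
by apply: (addrI (D (replace u i 0))); rewrite -addD !addr0.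
Qed.

Lemma multilinear_sum f (i : 'I_n) u m (a : 'I_m -> F) (x : 'I_m -> V) :
    multilinear f ->
  f (replace u i (\sum_(k < m) a k *: x k)) =
    \sum_(k < m) a k * f (replace u i (x k)).
Proof.
move=> [addf scalef]; elim/big_rec2: _ => [|k y1 y2 _ <-].
  by rewrite -(scale0r 0) scalef mul0r.
by rewrite addf scalef.
Qed.

Lemma alternating_antisymmetric f :
  multilinear f -> vanishes_on_repeats f -> antisymmetric_map f.
Proof.
move=> [addf _] altf u i j lt_ij.
have neq_ij : i != j by rewrite neq_ltn lt_ij.
pose g x y := f (replace (replace u i x) j y).
have gDl x1 x2 y : g (x1 + x2) y = g x1 y + g x2 y.
  by rewrite /g !(replaceC _ _ _ neq_ij) addf.
have gDr x y1 y2 : g x (y1 + y2) = g x y1 + g x y2 by rewrite /g addf.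
have gxx x : g x x = 0.
  by apply: altf lt_ij _; rewrite !ffunE !eqxx (negbTE neq_ij).
have -> : f (swap u i j) = g (u j) (u i) by rewrite /g swap_replace.
have -> : f u = g (u i) (u j) by rewrite /g !replace_id.
apply/eqP; rewrite -addr_eq0; apply/eqP.
by rewrite -(gxx (u i + u j)) gDl !gDr !gxx add0r addr0 addrC.
Qed.

(** A permutation is a product of transpositions, each of which preserves vanishing, so no sign has
    to be tracked. *)
Lemma antisymmetric_perm_eq0 f v (s : {perm 'I_n}) :
  antisymmetric_map f -> f v = 0 -> f [ffun i => v (s i)] = 0.
Proof.
move=> antif fv0; have [ts -> /allP dts] := prod_tpermP s.
have swap0 (i j : 'I_n) w : f w = 0 -> f (swap w i j) = 0.
  move=> fw0; have [lt_ij|lt_ji|eq_ij] := ltngtP i j.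
  - by rewrite antif // fw0 oppr0.
  - by rewrite /swap tpermC antif // fw0 oppr0.
  - suff -> : swap w i j = w by [].
    by rewrite (val_inj eq_ij); apply/ffunP => k; rewrite ffunE tperm1 perm1.
elim: ts {dts} => [|t ts IHts].
  rewrite big_nil; suff -> : [ffun i => v ((1%g : {perm 'I_n}) i)] = v by [].
  by apply/ffunP => k; rewrite ffunE perm1.
have {IHts} := swap0 t.1 t.2 _ IHts; rewrite big_cons; congr (f _ = 0).
by apply/ffunP => k; rewrite !ffunE permM.
Qed.

(** Expanding every entry of [u] in [v] reduces [f u] to values of [f] on tuples [v (g i)]: a
    non-injective [g] repeats an entry, an injective one permutes [v]. *)
Lemma alternating_eq0 f v :
    multilinear f -> vanishes_on_repeats f -> spans v -> f v = 0 ->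
  forall u, f u = 0.
Proof.
move=> mulf altf span_v fv0.
have f_basis (g : 'I_n -> 'I_n) : f [ffun i => v (g i)] = 0.
  have [inj_g|/injectivePn[i [j neq_ij eq_g]]] := boolP (injectiveb g).
    rewrite -(antisymmetric_perm_eq0 (perm (injectiveP _ inj_g)) _ fv0).
      by congr f; apply/ffunP => i; rewrite !ffunE permE.
    exact: alternating_antisymmetric.
  have [lt_ij|lt_ji|/val_inj eq_ij] := ltngtP i j.
  - by apply: altf lt_ij _; rewrite !ffunE eq_g.
  - by apply: altf lt_ji _; rewrite !ffunE eq_g.
  - by rewrite eq_ij eqxx in neq_ij.
(* m counts the entries of u that are still to be expanded in the basis v. *)
have partial m (g : 'I_n -> 'I_n) u :
    (m <= n)%N -> (forall i : 'I_n, (m <= i)%N -> u i = v (g i)) -> f u = 0.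
  elim: m g u => [|m IHm] g u le_mn u_g.
    by rewrite -(f_basis g); congr f; apply/ffunP => i; rewrite ffunE u_g.
  pose i0 := Ordinal le_mn; rewrite -(replace_id u i0).
  have [a ->] := span_v (u i0); rewrite multilinear_sum // big1 // => k _.
  (* Slot [m] now holds [v k], so [g] is updated there to [k] and only the slots below [m]
     remain. *)
  rewrite (IHm (fun i => if i == i0 then k else g i)) ?mulr0 ?(ltnW le_mn) //.
  move=> i le_mi; rewrite ffunE; case: eqP => // /eqP neq_i.
  by rewrite u_g // ltn_neqAle le_mi eq_sym andbT.
move=> u; apply: (partial n id) => // i.
by rewrite leqNgt ltn_ord.
Qed.

(** Swapping two equal entries fixes [u], so [f u = - f u]; this forces zero once 2 is invertible,
    and characteristic 2 is covered by the hypothesis. *)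
Lemma antisymmetric_alternating f :
    antisymmetric_map f -> (2%N \in [pchar F] -> vanishes_on_repeats f) ->
  vanishes_on_repeats f.
Proof.
move=> antif char2f; have [/char2f //|nchar2] := boolP (2%N \in [pchar F]).
move=> u i j lt_ij eq_u; have swap_u : swap u i j = u.
  by apply/ffunP => k; rewrite ffunE; case: tpermP => [->|->|].
have /eqP := antif u i j lt_ij; rewrite swap_u -addr_eq0 -mulr2n -mulr_natr.
rewrite mulf_eq0 => /orP[/eqP //|two0].
by rewrite inE /= two0 in nchar2.
Qed.

Lemma multilinear_lincomb f1 f2 (a b : F) :
  multilinear f1 -> multilinear f2 -> multilinear (fun u => a * f1 u - b * f2 u).
Proof.
move=> [add1 scale1] [add2 scale2]; split=> [i u x y|i u c x].
  by rewrite add1 add2 !mulrDr opprD addrACA.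
by rewrite scale1 scale2 mulrBr !(mulrCA c).
Qed.

End Determinant.

Theorem corollary2p11 (n : nat) (hn : (1 <= n)%N)
    (F : fieldType) (V : lmodType F)
    (D1 : V ^ n -> F) (hD1 : is_ndeterminant D1)
    (D2 : V ^ n -> F) (hD2m : multilinear D2) (hD2a : antisymmetric_map D2)
    (hD2char2 : 2%N \in [pchar F] -> vanishes_on_repeats D2) :
  exists c : F,
    (forall T : V ^ n, D2 T = c * D1 T) /\ (is_ndeterminant D2 -> c != 0).
Proof.
have [[v Dv_neq0] _ _] := hD1.
have alt1 := ndeterminant_vanishes_on_repeats hD1.
have alt2 := antisymmetric_alternating hD2a hD2char2.
(* Evaluating at [v] forces the constant [D2 v / D1 v]. *)
have eqD T : D2 T = D2 v / D1 v * D1 T.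
  have /eqP : D1 v * D2 T - D2 v * D1 T = 0.
    apply: (alternating_eq0 (f := fun u => D1 v * D2 u - D2 v * D1 u) (v := v)).
    - exact/multilinear_lincomb/ndeterminant_multilinear.
    - move=> u i j lt_ij eq_u.
      by rewrite (alt1 u i j) // (alt2 u i j) // !mulr0 subrr.
    - exact: ndeterminant_spans hD1 Dv_neq0.
    - by rewrite mulrC subrr.
  by rewrite subr_eq0 mulrAC => /eqP <-; rewrite mulrC mulKf.
exists (D2 v / D1 v); split=> // - [[w D2w_neq0] _ _].
by apply: contraNneq D2w_neq0 => c0; rewrite eqD c0 mul0r.
Qed.
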